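(* Let $\mathcal{P}$ be a finite poset, let $M \in \mathrm{vec}^{\mathcal{P}}$, let $i \in \mathcal{P}$ and let $k \in \mathbb{N}$. Then \[ \dim_{\mathbb{k}} (H_k^{\downarrow} M)(i) \;=\; \beta_M^k(i). \]
   Context: $\mathbb{k}$ is a field. A poset $\mathcal{P}$ is viewed as a category with a unique morphism $x\to y$ iff $x\le y$; $\mathrm{vec}^{\mathcal{P}}$ denotes the category of functors $\mathcal{P}\to\mathrm{Vec}$ with finite dimensional values (pointwise finite dimensional representations); for $x\le y$ write $M(x\le y)\colon M(x)\to M(y)$ for the structure maps. For $j\in\mathcal{P}$, $\mathsf{P}_j\in\mathrm{vec}^{\mathcal{P}}$ is the indecomposable projective: the representation equal to $\mathbb{k}$ on the principal upset $\{q : q\ge j\}$, $0$ elsewhere, with identity maps inside the upset. Every $M\in\mathrm{vec}^{\mathcal{P}}$ ($\mathcal P$ finite) has a minimal projective resolution, unique up to isomorphism, whose terms are finite direct sums of modules $\mathsf{P}_j$. Betti tables: for $k\in\mathbb{N}$, $\beta_M^k\colon\mathcal{P}\to\mathbb{Z}$ assigns to $j$ the multiplicity of $\mathsf{P}_j$ in the $k$th homological degree of the minimal projective resolution of $M$. Möbius homology: for $M\in\mathrm{vec}^{\mathcal{P}}$ and $i\in\mathcal{P}$, let $C^{(i)}_n(M)=\bigoplus M(a_0)$, the sum over all chains $a_0<a_1<\dots<a_n=i$ in $\mathcal{P}$ (so $n\ge 0$), where the summand indexed by a chain is a copy of $M(a_0)$ (the value at its minimal element). The differential $\partial\colon C^{(i)}_n(M)\to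 C^{(i)}_{n-1}(M)$ sends $x$ in the summand of $(a_0<\dots<a_n)$ to $M(a_0\le a_1)(x)$ in the summand of $(a_1<\dots<a_n)$ plus $\sum_{k=1}^{n-1}(-1)^k x$ placed in the summand of the chain with $a_k$ omitted. (This is the relative chain complex $C_\bullet(\Delta\mathcal{P}_{\le i},\Delta\mathcal{P}_{<i};M)$ of order complexes with coefficients in $M$.) Define $(H_n^{\downarrow}M)(i)\coloneqq H_n(C^{(i)}_\bullet(M))$. *)

(* Defs.v *)
From HB Require Import structures.
From mathcomp Require Import all_boot all_order all_algebra.
Set Implicit Arguments. Unset Strict Implicit. Unset Printing Implicit Defensive.
Import Order.TTheory GRing.Theory.
Local Open Scope ring_scope.
Local Open Scope order_scope.

Section PosetReps.
Variables (F : fieldType) (d : Order.disp_t) (T : finPOrderType d).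

(* A pointwise finite dimensional representation of T: at x the space
   'rV[F]_(rdim x) (row vectors); for x <= y the structure map
   M(x <= y) : v |-> v *m rmap x y.  (rmap x y for x not <= y is junk and
   never used.) *)
Record rep := Rep {
  rdim : T -> nat;
  rmap : forall x y : T, 'M[F]_(rdim x, rdim y) }.

Definition is_rep (M : rep) : Prop :=
  (forall x : T, rmap M x x = 1%:M) /\
  (forall x y z : T, x <= y -> y <= z -> rmap M x y *m rmap M y z = rmap M x z).

Definition is_hom (M N : rep) (f : forall x, 'M[F]_(rdim M x, rdim N x)) : Prop :=
  forall x y : T, x <= y -> rmap M x y *m f y = f x *m rmap N x y.

(* P is isomorphic to (+)_j P_j^(m j): there are generators gen j (the rows,
   m j of them, in P(j)) whose images under P(j <= x), j <= x, form a basis of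
   P(x) (they span, and their number is dim P(x)). *)
Definition is_free (P : rep) (m : T -> nat) : Prop :=
  exists gen : forall j, 'M[F]_(m j, rdim P j),
    forall x : T, (\sum_(j : T | (j <= x)%O) m j)%N = rdim P x /\
              row_full (\sum_(j : T | (j <= x)%O) <<gen j *m rmap P j x>>)%MS.

Definition radical (P : rep) (x : T) : 'M[F]_(rdim P x) :=
  (\sum_(y : T | (y < x)%O) <<rmap P y x>>)%MS.

Record resolution (M : rep) := Resol {
  res_mult : nat -> T -> nat;
  res_mod : nat -> rep;
  res_d : forall k x, 'M[F]_(rdim (res_mod k.+1) x, rdim (res_mod k) x);
  res_eps : forall x, 'M[F]_(rdim (res_mod 0) x, rdim M x) }.

Definition is_min_proj_resolution (M : rep) (R : resolution M) : Prop :=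
  [/\ forall k, is_rep (res_mod R k),
      forall k, is_free (res_mod R k) (res_mult R k),
      forall k, is_hom (res_d R k),
      is_hom (res_eps R) &
      [/\ forall x, row_full (res_eps R x),
          forall x, (res_d R 0 x == kermx (res_eps R x))%MS,
          forall k x, (res_d R k.+1 x == kermx (res_d R k x))%MS &
          forall k x, (res_d R k x <= radical (res_mod R k) x)%MS]].

Definition betti (M : rep) (R : resolution M) (k : nat) (j : T) : nat :=
  res_mult R k j.

Definition is_chain (i : T) (n : nat) (t : n.+1.-tuple T) : bool :=
  sorted (fun a b : T => a < b) t && (tnth t ord_max == i).

Definition chains (i : T) (n : nat) : seq (n.+1.-tuple T) :=
  [seq t <- enum {: n.+1.-tuple T} | is_chain i t].

Definition nchains i n := size (chains i n).

Definition chain_at (i : T) (n : nat) (c : 'I_(nchains i n)) : n.+1.-tuple T :=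
  nth [tuple of nseq n.+1 i] (chains i n) c.

Definition cdim (M : rep) i n (c : 'I_(nchains i n)) : nat :=
  rdim M (thead (chain_at c)).

Definition dimC (M : rep) i n : nat := (\sum_(c < nchains i n) cdim M c)%N.

Definition rem_at (k : nat) (s : seq T) : seq T := take k s ++ drop k.+1 s.

Definition bd_block (M : rep) i n (c : 'I_(nchains i n.+1)) (c' : 'I_(nchains i n))
  : 'M[F]_(cdim M c, cdim M c') :=
  let s := val (chain_at c) in
  let s' := val (chain_at c') in
  (if behead s == s' then rmap M (thead (chain_at c)) (thead (chain_at c')) else 0)
  + \sum_(1 <= k < n.+1)
      (if rem_at k s == s' then (-1) ^+ k *: pid_mx (cdim M c) else 0).

Definition bd (M : rep) i n : 'M[F]_(dimC M i n.+1, dimC M i n) :=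
  @mxblock F _ _ (@cdim M i n.+1) (@cdim M i n) (fun c c' => bd_block M c c').

Definition mobius_hdim (M : rep) (i : T) (k : nat) : nat :=
  ((match k with
    | 0 => dimC M i 0
    | k'.+1 => \rank (kermx (bd M i k'))
    end) - \rank (bd M i k))%N.

End PosetReps.

(* Main.v *)
(** M |-> H_*(C^(i)(M)) is a homological functor.  It vanishes in positive
    degrees on free representations, because the decomposition of P into the
    parts generated at the various j gives a contracting homotopy, and H_0 is
    the quotient of M(i) by the radical.  Hence, for the syzygy K of a cover
    P -> M with kernel inside the radical, H_(k+1)(M) = H_k(K) and
    H_0(M) = H_0(P); since the resolution of M restricts to one of K, induction
    on k concludes. *)

From HB Require Import structures.
From mathcomp Require Import all_boot all_order all_algebra.
From mathcomp Require Import zify.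
Require Import Defs.
Set Implicit Arguments. Unset Strict Implicit. Unset Printing Implicit Defensive.
Import Order.TTheory GRing.Theory.
Local Open Scope ring_scope.
Local Open Scope order_scope.

(** * Chains as functions: the differential and a contracting homotopy *)

Section ChainFunctions.
Variables (F : fieldType) (d : Order.disp_t) (T : finPOrderType d).
Implicit Types (M N P : rep F T) (a b x : T) (s u : seq T).

(* A chain a :: s is given by its least element [a], in which the coefficients
   live, and the list [s] of the other elements, so that operations on [s] do not
   change the type of the coefficients.  Only the values at actual chains ending
   at i matter. *)
Definition chain_fun M := forall a : T, seq T -> 'rV[F]_(rdim M a).

(* The part of the differential that omits an inner element of the chain, as
   computed at a given target chain: an element [b] is inserted between [a] and the
   head of [s], or else further inside [s], which changes the sign. *)
Fixpoint insert_bd (n : nat) a (w : seq T -> 'rV[F]_n) s : 'rV[F]_n :=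
  if s is x :: s' then
    - (\sum_(b : T | (a < b) && (b < x)) w [:: b, x & s'])
    - insert_bd x (fun u => w (x :: u)) s'
  else 0.

Definition bd_fun M (w : chain_fun M) : chain_fun M := fun a s =>
  \sum_(b : T | b < a) w b (a :: s) *m rmap M b a + insert_bd a (w a) s.

Lemma insert_bdD n a (w w' : seq T -> 'rV[F]_n) s :
  insert_bd a (fun u => w u + w' u) s = insert_bd a w s + insert_bd a w' s.
Proof.
elim: s a w w' => [|x s IH] a w w' /=; first by rewrite addr0.
by rewrite IH big_split /= !opprD addrACA.
Qed.

Lemma insert_bdM n p a (w : seq T -> 'rV[F]_n) (B : 'M_(n, p)) s :
  insert_bd a (fun u => w u *m B) s = insert_bd a w s *m B.
Proof.
elim: s a w => [|x s IH] a w /=; first by rewrite mul0mx.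
by rewrite IH mulmxBl mulNmx mulmx_suml.
Qed.

Lemma insert_bdN n a (w : seq T -> 'rV[F]_n) s :
  insert_bd a (fun u => - w u) s = - insert_bd a w s.
Proof.
elim: s a w => [|x s IH] a w /=; first by rewrite oppr0.
by rewrite IH sumrN opprD !opprK.
Qed.

Lemma insert_bd_sum n a (Q : pred T) (w : T -> seq T -> 'rV[F]_n) s :
  insert_bd a (fun u => \sum_(b | Q b) w b u) s
  = \sum_(b | Q b) insert_bd a (w b) s.
Proof.
elim: s a w => [|x s IH] a w /=; first by rewrite big1.
by rewrite IH exchange_big /= -!sumrN -big_split.
Qed.

(** Each pair of insertions arises in two orders with opposite signs. The cancellation is explicit
    when at least one of the two falls in the first gap; pairs lying further on are left to the
    induction. *)
Lemma insert_bdK n a (w : seq T -> 'rV[F]_n) s :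
  insert_bd a (insert_bd a w) s = 0.
Proof.
elim: s a w => //= x s IH a w.
rewrite insert_bdD !insert_bdN IH oppr0 addr0 opprK insert_bd_sum.
rewrite big_split /= !sumrN big_split /= !sumrN !opprD !opprK addrA subrK.
apply/eqP; rewrite subr_eq0; apply/eqP.
rewrite (exchange_big_dep (fun b => (a < b) && (b < x))) /=; last first.
  by move=> b c /andP[_ bx] /andP[ac cb]; rewrite ac (lt_trans cb).
apply: eq_bigr => b /andP[ab bx]; apply: eq_bigl => c.
apply/idP/idP => [/andP[/andP[_ ->] /andP[_ ->]]|/andP[bc ->]] //.
by rewrite (lt_trans ab) //= ab bc.
Qed.

(** For c < b < a, omitting c and then b applies M(c <= b) and M(b <= a); by functoriality this
    cancels against omitting b first and then c. Omitting the least element commutes with a later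
    omission up to sign, and [insert_bdK] handles two inner ones. *)
Lemma bd_funK M (HM : is_rep M) (w : chain_fun M) a s :
  bd_fun (bd_fun w) a s = 0.
Proof.
case: HM => _ HM; rewrite /bd_fun insert_bdD insert_bdK addr0 insert_bd_sum.
under [X in _ + X]eq_bigr do rewrite insert_bdM.
rewrite (eq_bigr (fun b => \sum_(c | c < b) w c [:: b, a & s] *m rmap M c a
   - \sum_(c | (b < c) && (c < a)) w b [:: c, a & s] *m rmap M b a
   - insert_bd a (fun u => w b (a :: u)) s *m rmap M b a)); last first.
  move=> b ba /=; rewrite mulmxDl mulmxBl mulNmx !mulmx_suml addrA.
  congr (_ - _ - _); apply: eq_bigr => c cb.
  by rewrite -mulmxA HM // ltW.
rewrite !big_split /= !sumrN addrNK; apply/eqP; rewrite subr_eq0; apply/eqP.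
rewrite (exchange_big_dep (fun b => b < a)) /=; last first.
  by move=> b c /[swap]; apply: lt_trans.
by apply: eq_bigr => b ba; apply: eq_bigl => c; rewrite andbC.
Qed.

Lemma bd_fun_hom M N (f : forall x, 'M[F]_(rdim M x, rdim N x)) :
  is_hom f -> forall (w : chain_fun M) a s,
  bd_fun (fun a s => w a s *m f a) a s = bd_fun w a s *m f a.
Proof.
move=> hf w a s; rewrite /bd_fun mulmxDl insert_bdM mulmx_suml; congr (_ + _).
by apply: eq_bigr => b ba; rewrite -!mulmxA hf // ltW.
Qed.

(* The contracting homotopy: [p x j] sends a vector at [x] to its component
   along the generators at [j], and [cone p] moves this component from the
   summand of the chain [x :: s] to the one of [j :: x :: s]. *)
Definition cone M (p : forall x j, 'M[F]_(rdim M x, rdim M j))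
    (w : chain_fun M) : chain_fun M := fun a s =>
  if s is x :: s' then w x s' *m p x a else 0.

(** With h = [cone p] this is ∂h = 1 - h∂ on chains with at least two elements. The decomposition of
    the identity splits w a (x :: s) into its components at b <= a: those with b < a come from
    omitting the least element in ∂h, the one at a from h∂. By the naturality of [p], the terms of
    h∂ at b < x vanish unless a <= b, and those with a < b < x match the insertions between a and
    x. *)
Lemma bd_cone M (p : forall x j, 'M[F]_(rdim M x, rdim M j)) :
  (forall x, \sum_(j | j <= x) p x j *m rmap M j x = 1%:M) ->
  (forall x, rmap M x x = 1%:M) ->
  (forall b x j, b <= x -> j <= x ->
     rmap M b x *m p x j = if j <= b then p b j else 0) ->
  forall (w : chain_fun M) a x s, a < x ->
  bd_fun (cone p w) a (x :: s) = w a (x :: s) - bd_fun w x s *m p x a.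
Proof.
move=> p1 r1 pn w a x s ax.
have sumE : w a (x :: s) = w a (x :: s) *m p a a
    + \sum_(b | b < a) w a (x :: s) *m p a b *m rmap M b a.
  rewrite -[LHS]mulmx1 -p1 (bigD1 a) //= r1 mulmx1 mulmxDr; congr (_ + _).
  rewrite mulmx_sumr; apply: eq_big => [b|b _]; last by rewrite mulmxA.
  by rewrite lt_neqAle andbC.
rewrite /bd_fun /= mulmxDl mulmx_suml [X in _ = X - _]sumE insert_bdM.
rewrite [\sum_(b : T | b < x) _](bigID (fun b => a <= b)) /=.
rewrite [X in _ - (_ + X + _)]big1 ?addr0; last first.
  move=> b /andP[bx nab]; rewrite -mulmxA pn ?(ltW ax) ?(ltW bx) //.
  by rewrite (negPf nab) mulmx0.
rewrite [\sum_(b : T | (b < x) && (a <= b)) _](bigD1 a) ?ax ?lexx //=.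
rewrite -mulmxA pn ?(ltW ax) // lexx.
rewrite [w a (x :: s) *m _ + _]addrC -[RHS]addrA; congr (_ + _).
rewrite -(addrA (w a (x :: s) *m p a a)) opprD addrA subrr add0r opprD.
congr (- _ - _).
apply: eq_big => [b|b /andP[ab bx]].
  rewrite [a < b]lt_neqAle eq_sym [RHS]andbC andbA.
  by case: (b != a); case: (b < x); case: (a <= b).
by rewrite -mulmxA pn ?(ltW ax) ?(ltW bx) // (ltW ab).
Qed.
End ChainFunctions.

(** * Sums over tuples *)

Section TupleSums.
Variables (T : finType) (V : nmodType).

Lemma big_tuple_cons n (C : pred (n.+1.-tuple T)) (G : n.+1.-tuple T -> V) :
  \sum_(t | C t) G t
  = \sum_x \sum_(u : n.-tuple T | C [tuple of x :: u]) G [tuple of x :: u].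
Proof.
rewrite pair_big_dep /= (reindex (fun p : T * n.-tuple T => [tuple of p.1 :: p.2])) //=.
exists (fun t => (thead t, [tuple of behead t])) => [[x u] _|t _] /=.
  by congr (_, _); apply/val_inj.
by rewrite -tuple_eta.
Qed.

Lemma big_tuple_eq n (C : pred (seq T)) (f : seq T -> V) (s : seq T) :
  size s = n ->
  \sum_(u : n.-tuple T | C u) (if val u == s then f u else 0)
  = if C s then f s else 0.
Proof.
move=> /eqP szs; rewrite -big_mkcondr /=.
case: ifP => Cs; last first.
  by rewrite big1 // => u /andP[Cu /eqP us]; rewrite -us Cu in Cs.
rewrite (big_pred1 (Tuple szs)) // => u; rewrite /= -val_eqE /=.
by case: eqP => [->|]; rewrite ?Cs ?andbF.
Qed.
End TupleSums.

(** * The chain complex in matrices: functoriality, exactness, degree 0 *)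

Section ChainMatrices.
Variables (F : fieldType) (d : Order.disp_t) (T : finPOrderType d) (i : T).
Implicit Types (M N P : rep F T) (a b x : T) (s u : seq T).

Lemma is_chain_cons n x (u : n.-tuple T) :
  is_chain i [tuple of x :: u] = path <%O x u && (last x u == i).
Proof.
rewrite /is_chain /=; congr (_ && (_ == _)).
by rewrite (tnth_nth x) /= -[n in nth _ _ n](size_tuple u) nth_last.
Qed.

Lemma chain_atP n (c : 'I_(nchains i n)) : is_chain i (chain_at c).
Proof.
have := mem_nth [tuple of nseq n.+1 i] (ltn_ord c).
by rewrite mem_filter => /andP[].
Qed.

Lemma chain_at_inj n : injective (@chain_at _ T i n).
Proof.
move=> c c' /eqP; rewrite nth_uniq //; first by move/eqP/val_inj.
by rewrite filter_uniq ?enum_uniq.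
Qed.

Lemma sum_chain_at n (V : nmodType) (G : n.+1.-tuple T -> V) :
  \sum_(c < nchains i n) G (chain_at c) = \sum_(t | is_chain i t) G t.
Proof.
transitivity (\sum_(t <- chains i n) G t).
  by rewrite (big_nth [tuple of nseq n.+1 i]) big_mkord.
by rewrite big_filter big_enum_cond.
Qed.

(** The shift [k.-1] is there because the element of index k in the chain a :: u has index k - 1 in
    u. One step of the recursion splits off the term k = 1. *)
Lemma insert_bdE n m a (w : seq T -> 'rV[F]_m) s :
  size s = n -> path <%O a s -> last a s = i ->
  insert_bd a w s = \sum_(u : n.+1.-tuple T | path <%O a u && (last a u == i))
    \sum_(1 <= k < n.+1)
      (if rem_at k.-1 u == s then (-1) ^+ k *: w u else 0).
Proof.
elim: s n a w => [|x s IH] [|n] a w //=.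
  by move=> _ _ _; rewrite big1 // => u _; rewrite big_geq.
case=> szs /andP[ax pxs] lxs; rewrite big_tuple_cons.
under [RHS]eq_bigr do under eq_bigr do rewrite big_ltn // big_add1.
under [RHS]eq_bigr do rewrite big_split.
rewrite big_split /= (IH n) //; congr (_ + _).
  rewrite -sumrN big_mkcond; apply: eq_bigr => y _.
  rewrite /rem_at /=; under eq_bigr do rewrite drop0 expr1 scaleN1r.
  rewrite (big_tuple_eq (fun u => (a < y) && path <%O y u && (last y u == i))
    (fun u => - w (y :: u))) /= ?szs //.
  by rewrite pxs lxs eqxx !andbT.
(* The remaining omissions keep the head of the tuple, so only the head x contributes. *)
rewrite (bigD1 x) //= [X in _ + X]big1 ?addr0; last first.
  move=> y yx; apply: big1 => u _; apply: big1_seq => k /andP[_].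
  rewrite mem_index_iota => /andP[k0 _].
  by case: k k0 => // k _; rewrite /rem_at /= eqseq_cons (negPf yx).
rewrite -sumrN ax; apply: eq_bigr => u _; rewrite -sumrN.
apply: eq_big_seq => k; rewrite mem_index_iota => /andP[k0 _].
case: k k0 => // k _; rewrite /rem_at /= eqseq_cons eqxx /=.
by case: ifP; rewrite ?oppr0 // [in RHS]exprS mulN1r scaleNr.
Qed.

(** Every row of C_n arises in this way ([chain_row_surj]), so that identities of matrices can be
    checked on chain functions. *)
Definition chain_row M n (w : chain_fun M) : 'rV[F]_(dimC M i n) :=
  @mxrow F _ (@cdim _ _ _ M i n) 1
    (fun c => w (thead (chain_at c)) (behead (chain_at c))).

Lemma eq_chain_row M n (w w' : chain_fun M) :
  (forall a s, size s = n -> path <%O a s -> last a s = i -> w a s = w' a s) ->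
  chain_row n w = chain_row n w'.
Proof.
move=> eq_w; apply: eq_mxrow => c; rewrite /cdim; move: (chain_atP c).
move: (chain_at c) => t; rewrite (tuple_eta t) is_chain_cons => /andP[p /eqP l].
by apply: eq_w => //=; rewrite size_tuple.
Qed.

Lemma chain_row_inj M n (w w' : chain_fun M) : chain_row n w = chain_row n w' ->
  forall a s, size s = n -> path <%O a s -> last a s = i -> w a s = w' a s.
Proof.
move=> eq_w a s /eqP szs p l.
have /(nthP [tuple of nseq n.+1 i])[c ltc tc] :
    [tuple of a :: Tuple szs] \in chains i n.
  by rewrite mem_filter mem_enum is_chain_cons /= p l eqxx.
have {}tc : chain_at (Ordinal ltc) = [tuple of a :: Tuple szs] by [].
have := congr1 (fun v : 'rV_(\sum_c cdim M c) => submxrow v (Ordinal ltc)) eq_w.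
by rewrite /chain_row !mxrowK /cdim tc.
Qed.

Lemma chain_row_surj M n (v : 'rV_(dimC M i n)) :
  exists w : chain_fun M, v = chain_row n w.
Proof.
(* [pid_mx] acts as a cast from dimension [cdim M c] to [rdim M a]; it is the identity when c is the
   chain a :: s. *)
exists (fun a s => \sum_(c < nchains i n)
  if val (chain_at c) == a :: s
  then submxrow (v : 'rV_(\sum_c cdim M c)) c *m pid_mx (rdim M a) else 0).
rewrite /chain_row -[LHS](@submxrowK _ _ (@cdim _ _ _ M i n)).
apply: eq_mxrow => c.
have eta_c : thead (chain_at c) :: behead (chain_at c) = chain_at c.
  by rewrite [in RHS](tuple_eta (chain_at c)).
rewrite (bigD1 c) //= eta_c eqxx pid_mx_1 mulmx1 big1 ?addr0 // => c' c'c.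
by rewrite val_eqE (inj_eq (@chain_at_inj n)) (negPf c'c).
Qed.

(** The block product gathers at a target chain a :: s what all source chains send there: b :: a ::
    s by omitting b, and chains with least element a by omitting an inner element. *)
Lemma chain_row_bd M n (w : chain_fun M) :
  chain_row n.+1 w *m bd M i n = chain_row n (bd_fun w).
Proof.
rewrite /chain_row /bd mul_mxrow_mxblock; apply: eq_mxrow => c'.
rewrite /bd_block /cdim; move: (chain_atP c').
move: (chain_at c') => t' ct'.
rewrite (@sum_chain_at _ _ (fun t => w (thead t) (behead t) *m (
  (if behead t == val t' then rmap M (thead t) (thead t') else 0)
  + \sum_(1 <= k < n.+1) (if rem_at k t == t' then
      (-1) ^+ k *: pid_mx (rdim M (thead t)) else 0)))).
case: (tupleP t') ct' => a s; rewrite is_chain_cons => /andP[p /eqP l].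
rewrite /= theadE big_tuple_cons.
under eq_bigr do under eq_bigr do rewrite mulmxDr.
under eq_bigr do rewrite big_split.
rewrite big_split /= /bd_fun; congr (_ + _).
  rewrite [RHS]big_mkcond; apply: eq_bigr => b _.
  pose f u := w b u *m rmap M b a.
  rewrite (eq_bigr (fun u : n.+1.-tuple T => if val u == a :: s then f u else 0)).
    rewrite (eq_bigl (fun u : n.+1.-tuple T =>
      path <%O b u && (last b u == i))); last by move=> u; rewrite is_chain_cons.
    rewrite (big_tuple_eq (fun u => path <%O b u && (last b u == i))) /=.
      by rewrite p l eqxx !andbT.
    by rewrite size_tuple.
  by move=> u _; rewrite /f theadE; case: ifP => // _; rewrite mulmx0.
rewrite (bigD1 a) //= [X in _ + X]big1 ?addr0; last first.
  move=> y ya; apply: big1 => u _; rewrite big1_seq ?mulmx0 // => k /andP[_].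
  rewrite mem_index_iota => /andP[k0 _].
  by case: k k0 => // k _; rewrite /rem_at /= eqseq_cons (negPf ya).
rewrite (insert_bdE (w a) (size_tuple s)) //.
rewrite (eq_bigl (fun u : n.+1.-tuple T =>
  path <%O a u && (last a u == i))); last by move=> u; rewrite is_chain_cons.
apply: eq_bigr => u _; rewrite theadE mulmx_sumr.
apply: eq_big_seq => k; rewrite mem_index_iota => /andP[k0 _].
case: k k0 => // k _; rewrite /rem_at /= eqseq_cons eqxx /=.
by case: ifP; rewrite ?mulmx0 // -scalemxAr pid_mx_1 mulmx1.
Qed.

(** Column block c is the projection onto the summand c followed by f, which avoids comparing source
    and target chains. *)
Definition chain_mx M N n (f : forall x, 'M[F]_(rdim M x, rdim N x)) :
    'M[F]_(dimC M i n, dimC N i n) :=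
  @mxrow F _ (@cdim _ _ _ N i n) (dimC M i n) (fun c =>
    @submxrow F _ (@cdim _ _ _ M i n) _ 1%:M c *m f (thead (chain_at c))).

Lemma chain_row_mx M N n (f : forall x, 'M[F]_(rdim M x, rdim N x))
    (w : chain_fun M) :
  chain_row n w *m chain_mx n f = chain_row n (fun a s => w a s *m f a).
Proof.
rewrite /chain_mx mul_mxrow; apply: eq_mxrow => c.
by rewrite mulmxA mul_submxrow mulmx1 mxrowK.
Qed.

Lemma chain_mx_bd M N n (f : forall x, 'M[F]_(rdim M x, rdim N x)) :
  is_hom f -> bd M i n *m chain_mx n f = chain_mx n.+1 f *m bd N i n.
Proof.
move=> hf; apply/row_matrixP => j; rewrite !row_mul.
rewrite -[row j (bd _ _ _)]/(row j (bd M i n)) !rowE -!mulmxA.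
have [w ->] := chain_row_surj (delta_mx 0 j).
rewrite !mulmxA chain_row_mx !chain_row_bd chain_row_mx.
by apply: eq_chain_row => a s _ _ _; rewrite bd_fun_hom.
Qed.

Lemma chain_row0 M n : chain_row n (fun a _ => 0 : 'rV[F]_(rdim M a)) = 0.
Proof. by apply/rowP => j; rewrite !mxE. Qed.

Lemma row_chainP M n q (A B : 'M[F]_(dimC M i n, q)) :
  (forall w : chain_fun M, chain_row n w *m A = chain_row n w *m B) -> A = B.
Proof.
move=> eqAB; apply/row_matrixP => j; rewrite !rowE.
by have [w ->] := chain_row_surj (delta_mx 0 j).
Qed.

Lemma row_chain_subP M n q r (A : 'M[F]_(dimC M i n, q)) (B : 'M[F]_(r, q)) :
  (forall w : chain_fun M, (chain_row n w *m A <= B)%MS) -> (A <= B)%MS.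
Proof.
move=> sAB; apply/row_subP => j; rewrite rowE.
by have [w ->] := chain_row_surj (delta_mx 0 j).
Qed.

Lemma bdK M n : is_rep M -> bd M i n.+1 *m bd M i n = 0.
Proof.
move=> HM; apply: row_chainP => w.
rewrite mulmxA !chain_row_bd mulmx0 -chain_row0.
by apply: eq_chain_row => a s _ _ _; rewrite bd_funK.
Qed.

(** C^(i)_n is a finite direct sum of evaluations at points, hence an exact functor: injectivity
    here, then surjectivity and exactness, are inherited from the pointwise statements. *)
Lemma chain_mx_free M N n (f : forall x, 'M[F]_(rdim M x, rdim N x)) :
  (forall x, row_free (f x)) -> row_free (chain_mx n f).
Proof.
move=> ff; apply: inj_row_free => v; have [w ->] := chain_row_surj v.
rewrite chain_row_mx -chain_row0 => /chain_row_inj wf0.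
rewrite -chain_row0; apply: eq_chain_row => a s sz p l.
by apply: (row_free_inj (ff a)); rewrite mul0mx wf0.
Qed.

Lemma chain_mx_full M N n (f : forall x, 'M[F]_(rdim M x, rdim N x)) :
  (forall x, row_full (f x)) -> row_full (chain_mx n f).
Proof.
move=> ff; rewrite -sub1mx; apply: row_chain_subP => w; rewrite mulmx1.
apply/submxP; exists (chain_row n (fun a s => w a s *m pinvmx (f a))).
rewrite chain_row_mx; apply: eq_chain_row => a s _ _ _.
by rewrite mulmxKpV // submx_full.
Qed.

Lemma chain_mx_ker M N P n (f : forall x, 'M[F]_(rdim M x, rdim N x))
    (g : forall x, 'M[F]_(rdim N x, rdim P x)) :
  (forall x, (f x == kermx (g x))%MS) ->
  (chain_mx n f == kermx (chain_mx n g))%MS.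
Proof.
move=> fg; apply/andP; split.
  apply: row_chain_subP => w; apply/sub_kermxP; rewrite !chain_row_mx -chain_row0.
  apply: eq_chain_row => a s _ _ _; apply/sub_kermxP.
  by rewrite -(eqmxP (fg a)) submxMl.
apply/rV_subP => v /sub_kermxP; have [w ->] := chain_row_surj v.
rewrite chain_row_mx -chain_row0 => /chain_row_inj wg0.
apply/submxP; exists (chain_row n (fun a s => w a s *m pinvmx (f a))).
rewrite chain_row_mx; apply: eq_chain_row => a s sz p l.
by rewrite mulmxKpV // (eqmxP (fg a)); apply/sub_kermxP/wg0.
Qed.

(** By [bd_cone], a cycle of degree n + 1 is the boundary of its cone; the degree is positive, so
    its chains have the two elements required there. *)
Lemma bd_exact M n (p : forall x j, 'M[F]_(rdim M x, rdim M j)) :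
  is_rep M ->
  (forall x, \sum_(j | j <= x) p x j *m rmap M j x = 1%:M) ->
  (forall b x j, b <= x -> j <= x ->
     rmap M b x *m p x j = if j <= b then p b j else 0) ->
  (bd M i n.+1 == kermx (bd M i n))%MS.
Proof.
move=> HM p1 pn; apply/andP; split; first by apply/sub_kermxP/bdK.
apply/rV_subP => v /sub_kermxP; have [w ->] := chain_row_surj v.
rewrite chain_row_bd -chain_row0 => /chain_row_inj bw0.
apply/submxP; exists (chain_row n.+2 (cone p w)); rewrite chain_row_bd.
apply: eq_chain_row => a [|x s] //= [sz] /andP[ax px] lx.
by rewrite (bd_cone p1 HM.1 pn) // bw0 // mul0mx subr0.
Qed.

(* C^(i)_0(M) has a single summand M(i). *)
Definition chain0_mx M : 'M[F]_(rdim M i, dimC M i 0) :=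
  @mxrow F _ (@cdim _ _ _ M i 0) _ (fun c => pid_mx (rdim M i)).

Lemma mul_chain0_mx M (w : chain_fun M) :
  w i [::] *m chain0_mx M = chain_row 0 w.
Proof.
(* Only a = i occurs in degree 0; [pid_mx] again casts the value at i to the coefficient space at
   a. *)
pose w' : chain_fun M := fun a s => w i s *m pid_mx (rdim M i).
rewrite (@eq_chain_row _ _ w w').
  rewrite mul_mxrow; apply: eq_mxrow => c; rewrite /w'; congr (w i _ *m _).
  by apply/esym/nilP; rewrite /nilp size_behead size_tuple.
by move=> a [|//] _ _ /= ->; rewrite /w' pid_mx_1 mulmx1.
Qed.

Lemma chain0_mx_free M : row_free (chain0_mx M).
Proof.
apply: inj_row_free => v.
pose w : chain_fun M := fun a s => v *m pid_mx (rdim M i).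
have -> : v = w i [::] by rewrite /w pid_mx_1 mulmx1.
by rewrite mul_chain0_mx -chain_row0 => /chain_row_inj ->.
Qed.

Lemma dimC0 M : dimC M i 0 = rdim M i.
Proof.
apply/eqP; rewrite eqn_leq; apply/andP; split; last first.
  by rewrite -{1}(eqP (chain0_mx_free M)) rank_leq_col.
suff /eqP <- : row_full (chain0_mx M) by apply: rank_leq_row.
rewrite -sub1mx; apply: row_chain_subP => w.
by rewrite mulmx1 -mul_chain0_mx submxMl.
Qed.

(** A chain of degree 1 is y < i and its boundary map is M(y <= i); the images of these maps span
    the radical. *)
Lemma bd0_radical M : (bd M i 0 :=: radical M i *m chain0_mx M)%MS.
Proof.
apply/eqmxP/andP; split.
  apply: row_chain_subP => w; rewrite chain_row_bd -mul_chain0_mx submxMr //.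
  by rewrite /bd_fun addr0; apply: summx_sub_sums => b bi; rewrite genmxE submxMl.
rewrite sumsmxMr_gen; apply/sumsmx_subP => y yi.
rewrite genmxE (eqmxMr _ (genmxE _)); apply/row_subP => k.
rewrite rowE mulmxA.
(* The k-th basis vector of M(y), placed on the chain y < i. *)
pose w : chain_fun M := fun a s =>
  if a == y then delta_mx 0 k *m pid_mx (rdim M y) else 0.
apply/submxP; exists (chain_row 1 w); rewrite chain_row_bd -mul_chain0_mx.
rewrite /bd_fun addr0 (bigD1 y) //= /w eqxx pid_mx_1 mulmx1 big1 ?addr0 //.
by move=> b /andP[_ /negPf ->]; rewrite mul0mx.
Qed.

Lemma mobius_hdim0 M : mobius_hdim M i 0 = (rdim M i - \rank (radical M i))%N.
Proof.
congr (_ - _)%N; first exact: dimC0.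
by rewrite bd0_radical mxrankMfree ?chain0_mx_free.
Qed.

End ChainMatrices.

(** For a short exact sequence of complexes 0 -> A -> B -> C -> 0 with B exact in degree 1, the
    connecting map identifies H_1(C) with the kernel of H_0(A) -> H_0(B), that is, the boundaries of
    B lying in A modulo those of A. Only dimensions are compared, by rank-nullity. *)
Lemma mxrank_homology_shift (F : fieldType) (a1 a0 b2 b1 b0 c2 c1 c0 : nat)
    (dB1 : 'M[F]_(b2, b1)) (dB0 : 'M_(b1, b0))
    (dC1 : 'M_(c2, c1)) (dC0 : 'M_(c1, c0)) (dA0 : 'M_(a1, a0))
    (i1 : 'M_(a1, b1)) (i0 : 'M_(a0, b0))
    (p2 : 'M_(b2, c2)) (p1 : 'M_(b1, c1)) (p0 : 'M_(b0, c0)) :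
  row_free i1 -> row_free i0 -> row_full p2 -> row_full p1 ->
  (i1 == kermx p1)%MS -> (i0 == kermx p0)%MS ->
  dB1 *m p1 = p2 *m dC1 -> dB0 *m p0 = p1 *m dC0 -> dA0 *m i0 = i1 *m dB0 ->
  (dB1 == kermx dB0)%MS ->
  (\rank (kermx dC0) - \rank dC1 = \rank (dB0 :&: i0)%MS - \rank dA0)%N.
Proof.
move=> fi1 fi0 fp2 fp1 ip1 ip0 dp1 dp0 di exB.
have rC1 : \rank dC1 = \rank (dB1 *m p1) by rewrite dp1 (eqmxMfull _ fp2).
have rC0 : \rank dC0 = \rank (dB0 *m p0) by rewrite dp0 (eqmxMfull _ fp1).
have rA0 : \rank dA0 = \rank (i1 *m dB0) by rewrite -di mxrankMfree.
have e1 : \rank (dB1 :&: kermx p1)%MS = \rank (i1 :&: kermx dB0)%MS.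
  by rewrite capmxC (cap_eqmx (eqmx_sym (eqmxP ip1)) (eqmxP exB)).
have e0 : \rank (dB0 :&: kermx p0)%MS = \rank (dB0 :&: i0)%MS.
  by rewrite (cap_eqmx (eqmx_refl dB0) (eqmx_sym (eqmxP ip0))).
have := mxrank_mul_ker dB1 p1; have := mxrank_mul_ker dB0 p0.
have := mxrank_mul_ker i1 dB0; rewrite -rC1 -rC0 -rA0 e1 e0 (eqP fi1).
have := eqmx_rank exB; have := eqmx_rank ip1.
rewrite !mxrank_ker (eqP fi1) (eqP fp1).
have := rank_leq_row dB0; have := rank_leq_row p1; have := rank_leq_row dC0.
rewrite (eqP fp1); lia.
Qed.

(** * Free representations: independence of generators and the radical *)

Section FreeReps.
Variables (F : fieldType) (d : Order.disp_t) (T : finPOrderType d).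
Variables (P : rep F T) (m : T -> nat) (gen : forall j, 'M[F]_(m j, rdim P j)).
Hypotheses (HP : is_rep P)
  (szP : forall x : T, (\sum_(j : T | (j <= x)%O) m j)%N = rdim P x)
  (fullP : forall x : T,
    row_full (\sum_(j : T | (j <= x)%O) <<gen j *m rmap P j x>>)%MS).

(** A dimension count: each summand has rank at most m j, while the total rank is the sum of the m
    j, so every inequality is an equality. *)
Lemma gen_direct x :
  mxdirect (\sum_(j : T | (j <= x)%O) <<gen j *m rmap P j x>>)%MS /\
  forall j, j <= x -> row_free (gen j *m rmap P j x).
Proof.
have rk j : (\rank <<gen j *m rmap P j x>>%MS <= m j)%N.
  by rewrite genmxE rank_leq_row.
have le_sum : (\sum_(j : T | (j <= x)%O) \rank <<gen j *m rmap P j x>>%MS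
    <= \sum_(j : T | (j <= x)%O) m j)%N by exact: leq_sum.
have le_rk : (\rank (\sum_(j : T | (j <= x)%O) <<gen j *m rmap P j x>>)%MS
    <= \sum_(j : T | (j <= x)%O) \rank <<gen j *m rmap P j x>>%MS)%N.
  by rewrite mxrank_sum_leqif.
have rk_full := etrans (eqP (fullP x)) (esym (szP x)); rewrite rk_full in le_rk.
have eq_sum := anti_leq (introT andP (conj le_rk le_sum)).
split; first by rewrite mxdirectE /= rk_full eq_sum.
move=> j jx; have := leqif_sum (fun j (_ : (j <= x)%O) => leqif_eq (rk j)).
case=> _; rewrite -eq_sum eqxx => /esym/forall_inP/(_ j jx).
by rewrite genmxE.
Qed.

Lemma gen_indep x q (V : forall j, 'M[F]_(q, m j)) :
  \sum_(j | j <= x) V j *m (gen j *m rmap P j x) = 0 ->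
  forall j, j <= x -> V j = 0.
Proof.
have [dx fx] := gen_direct x; move=> V0 j jx.
apply: (row_free_inj (fx j jx)); rewrite mul0mx.
apply/eqP; rewrite -submx0 -(mxdirect_sumsP dx j jx) sub_capmx genmxE submxMl /=.
move/eqP: V0; rewrite (bigD1 j) //= addr_eq0 => /eqP ->.
rewrite eqmx_opp; apply: summx_sub_sums => k _.
by rewrite genmxE submxMl.
Qed.

(** Spanning provides coordinates c x j along the generators, and p x j is c x j times the
    generators at j. Uniqueness of coordinates gives naturality. *)
Lemma gen_projections : exists p : forall x j, 'M[F]_(rdim P x, rdim P j),
  [/\ forall x, \sum_(j | j <= x) p x j *m rmap P j x = 1%:M,
      forall x j, (p x j <= gen j)%MS &
      forall b x j, b <= x -> j <= x ->
        rmap P b x *m p x j = if j <= b then p b j else 0].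
Proof.
have [c c1] : exists c : forall x j, 'M[F]_(rdim P x, m j),
    forall x, \sum_(j | j <= x) c x j *m (gen j *m rmap P j x) = 1%:M.
  apply: (@fin_all_exists T (fun x => forall j, 'M[F]_(rdim P x, m j))
    (fun x c => \sum_(j | j <= x) c j *m (gen j *m rmap P j x) = 1%:M)) => x.
  have /sub_sumsmxP[u u1] := submx_full 1%:M (fullP x).
  have /fin_all_exists[c cE] j : exists c : 'M_(rdim P x, m j),
      u j *m <<gen j *m rmap P j x>>%MS = c *m (gen j *m rmap P j x).
    by apply/submxP; rewrite -(genmxE (gen j *m _)) submxMl.
  by exists c; rewrite u1; apply: eq_bigr => j _; rewrite cE.
exists (fun x j => c x j *m gen j); split=> [x|x j|b x j bx jx].
- by rewrite -c1; apply: eq_bigr => j _; rewrite mulmxA.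
- exact: submxMl.
(* Both terms are coordinates at x of the image of P(b): push forward and then expand, or expand at
   b, where only generators at j <= b occur, and then push forward. *)
have cn : rmap P b x *m c x j - (if j <= b then c b j else 0) = 0.
  apply: (gen_indep (x := x) (V := fun j =>
    rmap P b x *m c x j - (if j <= b then c b j else 0))) => //.
  under eq_bigr do rewrite mulmxBl.
  rewrite sumrB; apply/eqP; rewrite subr_eq0; apply/eqP.
  under eq_bigr do rewrite -mulmxA.
  rewrite -mulmx_sumr c1 mulmx1 -[LHS]mul1mx -(c1 b) mulmx_suml.
  rewrite big_mkcond [RHS]big_mkcond; apply: eq_bigr => k _.
  case: (boolP (k <= b)) => [kb|_]; last by rewrite mul0mx if_same.
  by rewrite (le_trans kb bx) -!mulmxA HP.2.
move/eqP: cn; rewrite subr_eq0 mulmxA => /eqP ->.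
by case: ifP; rewrite ?mul0mx.
Qed.

(** Since P(y) is spanned by generators from below y, the radical at i is spanned by those at j < i,
    a subfamily of a direct sum. *)
Lemma rank_radical_gen i : \rank (radical P i) = (\sum_(j | (j < i)%O) m j)%N.
Proof.
have [p [p1 pg _]] := gen_projections.
have eqR : (radical P i :=: \sum_(j : T | (j < i)%O) <<gen j *m rmap P j i>>)%MS.
  apply/eqmxP/andP; split; apply/sumsmx_subP => y yi; rewrite genmxE; last first.
    by rewrite (sumsmx_sup y) // genmxE submxMl.
  rewrite -[rmap P y i]mul1mx -p1 mulmx_suml summx_sub // => j jy.
  rewrite (sumsmx_sup j) ?(le_lt_trans jy) // genmxE.
  by rewrite -mulmxA HP.2 ?(ltW yi) // submxMr.
rewrite eqR; have [dx fx] := gen_direct i.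
have dR : mxdirect (\sum_(j : T | (j < i)%O) <<gen j *m rmap P j i>>)%MS.
  apply/mxdirect_sumsP => j ji; apply/eqP; rewrite -submx0.
  rewrite -[X in (_ <= X)%MS](mxdirect_sumsP dx j (ltW ji)) capmxS //.
  apply/sumsmx_subP => k /andP[ki kj].
  by rewrite (sumsmx_sup k) // (ltW ki).
rewrite (mxdirectP dR) /=; apply: eq_bigr => j ji.
by rewrite genmxE (eqP (fx j (ltW ji))).
Qed.

Lemma rdim_gen i : rdim P i = (m i + \rank (radical P i))%N.
Proof.
rewrite rank_radical_gen -szP (bigD1 i) //=; congr (_ + _)%N.
by apply: eq_bigl => j; rewrite lt_neqAle andbC.
Qed.

End FreeReps.

Lemma bd_free_exact F d (T : finPOrderType d) (P : rep F T) m (i : T) n :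
  is_rep P -> is_free P m -> (bd P i n.+1 == kermx (bd P i n))%MS.
Proof.
move=> HP [gen genP].
have [p [p1 _ pn]] := gen_projections HP (fun x => (genP x).1) (fun x => (genP x).2).
exact: bd_exact HP p1 pn.
Qed.

Lemma rdim_free F d (T : finPOrderType d) (P : rep F T) m (i : T) :
  is_rep P -> is_free P m -> rdim P i = (m i + \rank (radical P i))%N.
Proof.
move=> HP [gen genP].
exact: (rdim_gen HP (fun x => (genP x).1) (fun x => (genP x).2)).
Qed.

(** * Comparing the homology of M with that of its syzygy *)

Section DimensionShift.
Variables (F : fieldType) (d : Order.disp_t) (T : finPOrderType d).
Variables (K P M : rep F T).
Variables (iota : forall x, 'M[F]_(rdim K x, rdim P x))
  (eps : forall x, 'M[F]_(rdim P x, rdim M x)).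
Hypotheses (HP : is_rep P) (hom_iota : is_hom iota) (hom_eps : is_hom eps)
  (iota_free : forall x, row_free (iota x))
  (eps_full : forall x, row_full (eps x))
  (iota_eps : forall x, (iota x == kermx (eps x))%MS)
  (iota_rad : forall x, (iota x <= radical P x)%MS).

(** As eps is surjective, it maps the radical of P onto that of M; as its kernel lies in the
    radical, the quotients by the radicals have the same dimension. *)
Lemma mobius_hdim0_cover i :
  mobius_hdim M i 0 = (rdim P i - \rank (radical P i))%N.
Proof.
have radE : (radical P i *m eps i :=: radical M i)%MS.
  apply: eqmx_trans (sumsmxMr_gen _ _ _) (eqmx_sums _) => y yi.
  apply: eqmx_trans (genmxE _) (eqmx_trans _ (eqmx_sym (genmxE _))).
  apply: eqmx_trans (eqmxMr _ (genmxE _)) _.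
  by rewrite hom_eps ?(ltW yi) //; apply: eqmxMfull.
have ker_rad : (kermx (eps i) <= radical P i)%MS.
  by rewrite -(eqmxP (iota_eps i)).
have := mxrank_mul_ker (radical P i) (eps i).
rewrite mobius_hdim0 radE capmxC (capmx_idPl ker_rad) mxrank_ker.
have := rank_leq_row (eps i); have := rank_leq_col (radical P i).
rewrite (eqP (eps_full i)); lia.
Qed.

(** After the rank form of the connecting map, it remains to see that the boundaries of C(P) lying
    in C(K) are exactly the cycles of C(K). *)
Lemma mobius_hdim_shift i k m : is_free P m ->
  mobius_hdim M i k.+1 = mobius_hdim K i k.
Proof.
move=> freeP; rewrite /mobius_hdim.
rewrite (mxrank_homology_shift (chain_mx_free i k.+1 iota_free)
  (chain_mx_free i k iota_free) (chain_mx_full i k.+2 eps_full)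
  (chain_mx_full i k.+1 eps_full) (chain_mx_ker i k.+1 iota_eps)
  (chain_mx_ker i k iota_eps) (chain_mx_bd i _ hom_eps) (chain_mx_bd i _ hom_eps)
  (chain_mx_bd i _ hom_iota) (bd_free_exact i k HP freeP)).
congr (_ - _)%N; case: k => [|k].
  (* In degree 0 the boundaries of C(P) form the radical, which contains K(i): the intersection is
     all of C_0(K). *)
  apply: etrans (eqP (chain_mx_free i 0 iota_free)); apply: eqmx_rank.
  rewrite capmxSr sub_capmx submx_refl andbT.
  apply: row_chain_subP => w; rewrite chain_row_mx -mul_chain0_mx bd0_radical.
  by rewrite submxMr // mulmx_sub.
(* In positive degree boundaries of C(P) are cycles, and the cycles of C(P) in C(K) are those of
   C(K). *)
have := mxrank_mul_ker (chain_mx i k.+1 iota) (bd P i k).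
rewrite -(chain_mx_bd i k hom_iota) mxrankMfree ?chain_mx_free //.
rewrite (eqP (chain_mx_free i k.+1 iota_free)) capmxC.
rewrite (cap_eqmx (eqmx_sym (eqmxP (bd_free_exact i k HP freeP))) (eqmx_refl _)).
rewrite mxrank_ker; lia.
Qed.
End DimensionShift.

(** * The syzygy and its shifted resolution *)

Section Syzygy.
Variables (F : fieldType) (d : Order.disp_t) (T : finPOrderType d).
Variables (M : rep F T) (R : resolution M).
Hypothesis HR : is_min_proj_resolution R.
Let P := res_mod R 0.
Let eps := res_eps R.

(** The kernel of eps in coordinates of a chosen basis; [pinvmx] reads a vector of the kernel back
    in these coordinates. *)
Definition syzygy : rep F T :=
  @Rep F d T (fun x => \rank (kermx (eps x))) (fun x y =>
    row_base (kermx (eps x)) *m rmap P x y *m pinvmx (row_base (kermx (eps y)))).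

Definition syzygy_incl x : 'M[F]_(rdim syzygy x, rdim P x) :=
  row_base (kermx (eps x)).

Definition syzygy_resolution : resolution syzygy :=
  @Resol F d T syzygy (fun k => res_mult R k.+1) (fun k => res_mod R k.+1)
    (fun k => res_d R k.+1) (fun x => res_d R 0 x *m pinvmx (syzygy_incl x)).

Lemma syzygy_incl_free x : row_free (syzygy_incl x).
Proof. exact: row_base_free. Qed.

Lemma syzygy_incl_ker x : (syzygy_incl x == kermx (eps x))%MS.
Proof. by apply/eqmxP/eq_row_base. Qed.

Lemma syzygy_incl_hom : is_hom syzygy_incl.
Proof.
move=> x y xy; rewrite /= mulmxKpV // (eqmxP (syzygy_incl_ker y)).
case: HR => _ _ _ /(_ x y xy) he _.
apply/sub_kermxP; rewrite -mulmxA he mulmxA.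
have /sub_kermxP-> : (row_base (kermx (eps x)) <= kermx (eps x))%MS.
  by rewrite eq_row_base.
by rewrite mul0mx.
Qed.

Lemma syzygy_epsK x : res_eps syzygy_resolution x *m syzygy_incl x = res_d R 0 x.
Proof.
case: HR => _ _ _ _ [_ d0 _ _].
by rewrite mulmxKpV // (eqmxP (syzygy_incl_ker x)) (eqmxP (d0 x)).
Qed.

Lemma syzygy_min_resolution : is_min_proj_resolution syzygy_resolution.
Proof.
case: HR => repP freeP homd home [epsf d0 dk drad].
(* The new augmentation followed by the injective inclusion is d_0, so the two kernels agree. *)
have kerE x : (kermx (res_d R 0 x) == kermx (res_eps syzygy_resolution x))%MS.
  rewrite -syzygy_epsK; apply/andP; split; last first.
    by apply/sub_kermxP; rewrite mulmxA mulmx_ker mul0mx.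
  apply/sub_kermxP/(row_free_inj (syzygy_incl_free x)).
  by rewrite -mulmxA mulmx_ker mul0mx.
split=> [k|k|k||]; [exact: repP|exact: freeP|exact: homd| |].
  move=> x y xy; apply: (row_free_inj (syzygy_incl_free y)).
  rewrite -[LHS]mulmxA -[RHS]mulmxA; rewrite syzygy_epsK syzygy_incl_hom //.
  rewrite mulmxA syzygy_epsK.
  exact: homd.
split=> [x|x|k x|k x].
- rewrite /row_full -(mxrankMfree _ (syzygy_incl_free x)) syzygy_epsK.
  by rewrite (eqmx_rank (d0 x)).
- exact/eqmxP/(eqmx_trans (eqmxP (dk 0 x)) (eqmxP (kerE x))).
- exact: dk.
- exact: drad.
Qed.
End Syzygy.

Theorem theoremA1 (F : fieldType) (d : Order.disp_t) (T : finPOrderType d)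
  (M : rep F T) (HM : is_rep M)
  (R : resolution M) (HR : is_min_proj_resolution R)
  (i : T) (k : nat) :
  mobius_hdim M i k = betti R k i.
Proof.
(* M and R are generalized since the induction passes to the syzygy. Its inclusion in the radical is
   minimality: the kernel of eps is the image of d_0. *)
elim: k M R {HM} HR => [|k IH] M R HR;
  have [repP freeP _ home [epsf d0 _ drad]] := HR;
  have syz_rad x : (syzygy_incl R x <= radical (res_mod R 0) x)%MS
    by rewrite (eqmxP (syzygy_incl_ker R x)) -(eqmxP (d0 x)) drad.
- rewrite (mobius_hdim0_cover home epsf (syzygy_incl_ker R) syz_rad).
  by rewrite {1}(rdim_free i (repP 0) (freeP 0)) addnK.
- rewrite (mobius_hdim_shift (repP 0) (syzygy_incl_hom HR) home
    (@syzygy_incl_free _ _ _ _ R) epsf (syzygy_incl_ker R) syz_rad _ _ (freeP 0)).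
  (* The multiplicities of the shifted resolution in degree k are by definition those of R in degree
     k + 1. *)
  exact: IH (syzygy_min_resolution HR).
Qed.
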